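(* Let $r$ be a nonnegative integer. For every integer $n\ge 0$, \[ H_n(x)=\frac{1}{2^r}\sum_{k=0}^{n}\left\{\sum_{j=0}^{r}\sum_{l=0}^{\lfloor (n-k)/2\rfloor}\frac{\binom{n}{k}\binom{r}{j}2^k(-1)^l(n-k)!\,(2j)^{n-k-2l}}{l!\,(n-k-2l)!}\right\}E_k^{(r)}(x), \] with the convention $0^0=1$.
   Context: The Hermite polynomials $H_n(x)$ are defined by $e^{2xt-t^2}=\sum_{n\ge0}H_n(x)\frac{t^n}{n!}$. The Euler polynomials of order $r$ are defined by $\left(\frac{2}{e^t+1}\right)^r e^{xt}=\sum_{n\ge0}E_n^{(r)}(x)\frac{t^n}{n!}$. *)

(* Defs.v *)
From HB Require Import structures.
From mathcomp Require Import all_boot all_order all_algebra.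
From mathcomp Require Import boolp.

Set Implicit Arguments.
Unset Strict Implicit.
Unset Printing Implicit Defensive.

Import Order.TTheory GRing.Theory Num.Theory.
Local Open Scope ring_scope.

(* Formal power series \sum_n (coefs f n) t^n in one variable t. *)
Record fps (R : Type) := Fps { coefs : nat -> R }.

Section FpsRing.
Variable R : comUnitRingType.
Implicit Types f g h : fps R.

Lemma fpsP f g : (forall n, coefs f n = coefs g n) -> f = g.
Proof. by case: f g => [f] [g] /= /funext ->. Qed.

(* Equality of series is not decidable: these instances are classical. *)
HB.instance Definition _ := gen_eqMixin (fps R).
HB.instance Definition _ := gen_choiceMixin (fps R).

Definition fps_add f g := Fps (fun n => coefs f n + coefs g n).
Definition fps_opp f := Fps (fun n => - coefs f n).
Definition fps_zero : fps R := Fps (fun=> 0).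
Definition fps_mul f g :=
  Fps (fun n => \sum_(i < n.+1) coefs f i * coefs g (n - i)%N).
Definition fps_one : fps R := Fps (fun n => (n == 0%N)%:R).

Fact fps_addA : associative fps_add.
Proof. by move=> f g h; apply: fpsP => n /=; rewrite addrA. Qed.
Fact fps_addC : commutative fps_add.
Proof. by move=> f g; apply: fpsP => n /=; rewrite addrC. Qed.
Fact fps_add0 : left_id fps_zero fps_add.
Proof. by move=> f; apply: fpsP => n /=; rewrite add0r. Qed.
Fact fps_addN : left_inverse fps_zero fps_opp fps_add.
Proof. by move=> f; apply: fpsP => n /=; rewrite addNr. Qed.

HB.instance Definition _ :=
  GRing.isZmodule.Build (fps R) fps_addA fps_addC fps_add0 fps_addN.

Definition fps_trunc m f : {poly R} := \poly_(i < m) coefs f i.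

Lemma coef_fps_trunc_mul m f g n : (n < m)%N ->
  (fps_trunc m f * fps_trunc m g)`_n = coefs (fps_mul f g) n.
Proof.
move=> nm; rewrite coefM; apply: eq_bigr => i _.
by rewrite !coef_poly (leq_ltn_trans _ nm) ?leq_ord //
  (leq_ltn_trans (leq_subr _ _) nm).
Qed.

Fact fps_mulC : commutative fps_mul.
Proof.
move=> f g; apply: fpsP => n.
by rewrite -!(coef_fps_trunc_mul _ _ (ltnSn n)) mulrC.
Qed.

Fact fps_mulA : associative fps_mul.
Proof.
move=> f g h; apply: fpsP => n.
pose T := fps_trunc n.+1.
have -> : coefs (fps_mul f (fps_mul g h)) n = (T f * (T g * T h))`_n.
  rewrite coefM /=; apply: eq_bigr => i _.
  rewrite [in RHS]coef_poly ltn_ord.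
  by rewrite coef_fps_trunc_mul // ltnS leq_subr.
rewrite mulrA coefM /=; apply: eq_bigr => i _.
by rewrite (coef_fps_trunc_mul f g (ltn_ord i)) coef_poly ltnS leq_subr.
Qed.

Fact fps_mul1 : left_id fps_one fps_mul.
Proof.
move=> f; apply: fpsP => n /=.
by rewrite big_ord_recl /= mul1r subn0 big1 ?addr0 // => i _; rewrite mul0r.
Qed.

Fact fps_mulDl : left_distributive fps_mul fps_add.
Proof.
move=> f g h; apply: fpsP => n /=.
by rewrite -big_split; apply: eq_bigr => i _; rewrite mulrDl.
Qed.

Fact fps_one_neq0 : fps_one != 0.
Proof.
by apply/eqP => /(congr1 (fun f => coefs f 0)) /eqP; rewrite /= oner_eq0.
Qed.

HB.instance Definition _ := GRing.Zmodule_isComNzRing.Build (fps R)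
  fps_mulA fps_mulC fps_mul1 fps_mulDl fps_one_neq0.

(* The first n coefficients of 1/f, from \sum_(i <= n) g_i f_(n-i) = (n == 0). *)
Fixpoint fps_inv_seq f n : seq R :=
  if n is m.+1 then
    let s := fps_inv_seq f m in
    rcons s ((coefs f 0)^-1 *
             ((m == 0%N)%:R - \sum_(i < m) s`_i * coefs f (m - i)%N))
  else [::].

Definition fps_unit : {pred fps R} := fun f => coefs f 0 \is a GRing.unit.
Definition fps_inv f :=
  if fps_unit f then Fps (fun n => (fps_inv_seq f n.+1)`_n) else f.

Lemma size_fps_inv_seq f n : size (fps_inv_seq f n) = n.
Proof. by elim: n => //= n IHn; rewrite size_rcons IHn. Qed.

Lemma nth_fps_inv_seq f n i : (i < n)%N ->
  (fps_inv_seq f n)`_i = (fps_inv_seq f i.+1)`_i.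
Proof.
elim: n => // n IHn; rewrite ltnS leq_eqVlt => /predU1P[-> //|lt_in].
by rewrite [LHS]nth_rcons size_fps_inv_seq lt_in IHn.
Qed.

Lemma fps_inv_coefE f n : let g i := (fps_inv_seq f i.+1)`_i in
  g n = (coefs f 0)^-1 *
        ((n == 0%N)%:R - \sum_(i < n) g i * coefs f (n - i)%N).
Proof.
rewrite /= nth_rcons size_fps_inv_seq ltnn eqxx; congr (_ * (_ - _)).
by apply: eq_bigr => i _; rewrite (nth_fps_inv_seq f (ltn_ord i)).
Qed.

Fact fps_mulVx : {in fps_unit, left_inverse 1 fps_inv *%R}.
Proof.
move=> f Uf; apply: fpsP => n; rewrite /fps_inv (Uf : fps_unit f).
have {}Uf : coefs f 0 \is a GRing.unit := Uf.
move: (fps_inv_coefE f n); set g := fun i => _ => /= gE.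
change (\sum_(i < n.+1) g i * coefs f (n - i)%N = (n == 0%N)%:R).
by rewrite big_ord_recr /= subnn gE mulrAC mulVr // mul1r addrC subrK.
Qed.

Fact fps_unitPl f g : g * f = 1 -> fps_unit f.
Proof.
move=> /(congr1 (fun h => coefs h 0)) /=; rewrite big_ord1 subnn => gf1.
by apply/unitrPr; exists (coefs g 0); rewrite mulrC.
Qed.

Fact fps_inv_out : {in [predC fps_unit], fps_inv =1 id}.
Proof. by move=> f /negbTE nUf; rewrite /fps_inv (nUf : fps_unit f = false). Qed.

HB.instance Definition _ := GRing.ComNzRing_hasMulInverse.Build (fps R)
  fps_mulVx fps_unitPl fps_inv_out.

Definition fpsC (c : R) : fps R := Fps (fun n => c *+ (n == 0%N)).
Definition fpsT : fps R := Fps (fun n => (n == 1%N)%:R).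

(* The composite \sum_k f^k / k!, meaningful when coefs f 0 = 0: then f^k has
   order at least k, so only the terms k <= n contribute to t^n. *)
Definition fps_exp f : fps R :=
  Fps (fun n => \sum_(k < n.+1) coefs (f ^+ k) n / k`!%:R).

(* \sum_n (a n) t^n / n! *)
Definition fps_egf (a : nat -> R) : fps R := Fps (fun n => a n / n`!%:R).

End FpsRing.

Arguments fpsT {R}.

Section Polynomials.
Variable F : numFieldType.

(* Below, {poly F} is the ring of coefficients, and its 'X is the x of H_n(x)
   and E_n^(r)(x). *)
Definition hermite_gf : fps {poly F} :=
  fps_exp (fpsC (2 * 'X) * fpsT - fpsT ^+ 2).

Definition euler_gf (r : nat) : fps {poly F} :=
  (2 / (fps_exp fpsT + 1)) ^+ r * fps_exp (fpsC 'X * fpsT).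

Definition hermite (n : nat) : {poly F} := n`!%:R * coefs hermite_gf n.
Definition euler (r n : nat) : {poly F} := n`!%:R * coefs (euler_gf r) n.

Lemma fact_poly_unit n : (n`!%:R : {poly F}) \is a GRing.unit.
Proof.
by rewrite -polyC_natr poly_unitE size_polyC coefC eqxx unitfE pnatr_eq0 -lt0n
  fact_gt0.
Qed.

Lemma hermite_egf : hermite_gf = fps_egf hermite.
Proof.
apply: fpsP => n; rewrite [RHS]/= /hermite.
by rewrite [n`!%:R * _]mulrC mulrK ?fact_poly_unit.
Qed.

Lemma euler_egf r : euler_gf r = fps_egf (euler r).
Proof.
apply: fpsP => n; rewrite [RHS]/= /euler.
by rewrite [n`!%:R * _]mulrC mulrK ?fact_poly_unit.
Qed.

Lemma euler_den_unit : (fps_exp fpsT + 1 : fps {poly F}) \is a GRing.unit.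
Proof.
change (coefs (fps_exp fpsT + 1 : fps {poly F}) 0 \is a GRing.unit).
by rewrite /= big_ord1 /= fact0 divr1 -[1 + 1]/(2`!%:R) fact_poly_unit.
Qed.

End Polynomials.

(* Main.v *)
(* Substituting 2t for t in the generating function of the Euler polynomials
   gives (2 / (e^(2t) + 1))^r e^(2xt), so that 2^r e^(2xt - t^2) is the product
   of this series with (e^(2t) + 1)^r e^(-t^2).  The second factor expands by the
   binomial theorem into \sum_j 'C(r, j) e^(2jt) e^(-t^2), and the identity is
   the comparison of the coefficients of t^n. *)
Require Import Defs.
From mathcomp Require Import all_boot all_order all_algebra.
From mathcomp Require Import ring.

Import Order.TTheory GRing.Theory Num.Theory.
Local Open Scope ring_scope.

(** * Exponentials and rescaling of formal power series *)

Section FpsCoefficients.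
Variable R : comUnitRingType.
Implicit Types (f g : fps R) (a c : R).

Lemma coefsM f g n :
  coefs (f * g) n = \sum_(i < n.+1) coefs f i * coefs g (n - i)%N.
Proof. by []. Qed.

Lemma coefsN f n : coefs (- f) n = - coefs f n.
Proof. by []. Qed.

Lemma coefs_sum (I : Type) (s : seq I) (P : pred I) (G : I -> fps R) n :
  coefs (\sum_(i <- s | P i) G i) n = \sum_(i <- s | P i) coefs (G i) n.
Proof. by elim/big_rec2: _ => //= i y z _ <-. Qed.

Lemma coefsMn f m n : coefs (f *+ m) n = coefs f n *+ m.
Proof. by elim: m => [|m IHm] //; rewrite !mulrS -IHm. Qed.

Lemma coefs_fpsCM a f n : coefs (fpsC a * f) n = a * coefs f n.
Proof.
rewrite coefsM big_ord_recl /= subn0 big1 ?addr0 // => i _.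
by rewrite mulr0n mul0r.
Qed.

Lemma coefs_fpsTX k n : coefs (fpsT ^+ k : fps R) n = (n == k)%:R.
Proof.
elim: k n => [|k IHk] [|n] //; rewrite exprS coefsM.
  by rewrite big_ord1 mul0r.
rewrite 2!big_ord_recl /= mul0r add0r mul1r subn1 IHk eqSS.
by rewrite big1 ?addr0 // => i _; rewrite mul0r.
Qed.

Lemma fpsCX a k : fpsC a ^+ k = fpsC (a ^+ k).
Proof.
elim: k => [|k IHk]; first by apply: fpsP => -[|n].
by rewrite exprS IHk; apply: fpsP => n; rewrite coefs_fpsCM /= mulrnAr -exprS.
Qed.

Lemma fpsCMn a j : fpsC a *+ j = fpsC (a *+ j).
Proof. by apply: fpsP => n; rewrite coefsMn /= mulrnAC. Qed.

Lemma coefsX_small f k n : coefs f 0 = 0 -> (n < k)%N -> coefs (f ^+ k) n = 0.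
Proof.
move=> f0; elim: k n => // k IHk n lt_nk; rewrite exprS coefsM big1 // => i _.
case: (posnP i) => [-> | i_gt0]; first by rewrite f0 mul0r.
rewrite IHk ?mulr0 // ltn_subLR ?leq_ord //.
by rewrite (leq_trans lt_nk) // -add1n leq_add2r.
Qed.

(** The range of summation is freed from its dependence on [n], so that sums over different
    coefficients can be exchanged. *)
Lemma coefs_exp_widen f n N : coefs f 0 = 0 -> (n < N)%N ->
  coefs (fps_exp f) n = \sum_(k < N) coefs (f ^+ k) n / k`!%:R.
Proof.
move=> f0 lt_nN.
rewrite /= (big_ord_widen N (fun k => coefs (f ^+ k) n / k`!%:R)) //.
rewrite big_mkcond; apply: eq_bigr => k _.
by case: ltnP => // lt_nk; rewrite coefsX_small ?mul0r.
Qed.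

Lemma coefs_expCT a n : coefs (fps_exp (fpsC a * fpsT)) n = a ^+ n / n`!%:R.
Proof.
rewrite /= big_ord_recr big1 /= => [|k _].
  by rewrite add0r exprMn fpsCX coefs_fpsCM coefs_fpsTX eqxx mulr1.
rewrite exprMn fpsCX coefs_fpsCM coefs_fpsTX.
by rewrite gtn_eqF ?mulr0 ?mul0r ?ltn_ord.
Qed.

Lemma fps_exp0 : fps_exp (0 : fps R) = 1.
Proof.
apply: fpsP => n; rewrite /= big_ord_recl big1 /= => [|k _].
  by rewrite fact0 divr1 addr0.
by rewrite exprS mul0r mul0r.
Qed.

Hypothesis fact_unit : forall n, (n`!%:R : R) \is a GRing.unit.

(** By the binomial theorem, [(f + g) ^+ s / s!] is the sum of [f ^+ k * g ^+ l / (k! * l!)] over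
    [k + l = s]. *)
Lemma fps_expD f g : coefs f 0 = 0 -> coefs g 0 = 0 ->
  fps_exp (f + g) = fps_exp f * fps_exp g.
Proof.
move=> f0 g0; apply: fpsP => n.
pose G k l := coefs (f ^+ k * g ^+ l) n / (k`!%:R * l`!%:R).
have G0 k l : (n < k + l)%N -> G k l = 0.
  (* In each term of the Cauchy product, either [i < k] or [n - i < l]. *)
  move=> lt_n_kl; rewrite /G coefsM big1 ?mul0r // => i _.
  have [lt_ik | le_ki] := ltnP i k; first by rewrite coefsX_small ?mul0r.
  rewrite [X in _ * X]coefsX_small ?mulr0 // ltn_subLR ?leq_ord //.
  by rewrite (leq_trans lt_n_kl) // leq_add2r.
(* Both sides are the sum of G over the square k, l <= n: by G0 only the
   triangle k + l <= n contributes to it. *)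
transitivity (\sum_(k < n.+1) \sum_(l < n.+1) G k l); last first.
  transitivity (\sum_(i < n.+1) \sum_(k < n.+1) \sum_(l < n.+1)
      coefs (f ^+ k) i / k`!%:R * (coefs (g ^+ l) (n - i) / l`!%:R)).
    rewrite [RHS]exchange_big /=; apply: eq_bigr => k _.
    rewrite [RHS]exchange_big /=; apply: eq_bigr => l _.
    rewrite /G coefsM mulr_suml; apply: eq_bigr => i _.
    by rewrite invrM // [X in _ * X = _]mulrC mulrACA.
  rewrite coefsM; apply: eq_bigr => i _.
  rewrite (coefs_exp_widen _ _ n.+1) // (coefs_exp_widen _ _ n.+1) //;
    last by rewrite ltnS leq_subr.
  by rewrite mulr_suml; apply: eq_bigr => k _; rewrite mulr_sumr.
transitivity (\sum_(s < n.+1) \sum_(l < s.+1) G (s - l)%N l).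
  apply: eq_bigr => s _; rewrite exprDn coefs_sum mulr_suml.
  apply: eq_bigr => l _; rewrite coefsMn mulrnAl -mulrnAr -mulr_natl.
  congr (_ * _).
  have le_ls : (l <= s)%N by rewrite -ltnS.
  have Ul := unitrM (s - l)`!%:R (l`!%:R : R).
  rewrite !fact_unit in Ul.
  apply: (mulIr Ul); rewrite mulVr // mulrAC -!natrM [(_ * l`!)%N]mulnC.
  by rewrite (bin_fact le_ls) divrr.
(* For fixed [l], the sum over [l <= s <= n] is reindexed by [k = s - l], which runs up to [n - l];
   beyond that [G0] applies. *)
under eq_bigr => s _ do
  rewrite (big_ord_widen n.+1 (fun l => G (s - l)%N l)) ?ltn_ord //.
rewrite (exchange_big_dep xpredT) //= [RHS]exchange_big.
apply: eq_bigr => l _; under eq_bigl => s do rewrite ltnS.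
rewrite -(big_geq_mkord _ _ xpredT (fun s => G (s - l)%N l)) -{1}[l : nat]add0n.
rewrite big_addn big_mkord; under [LHS]eq_bigr => k _ do rewrite addnK.
rewrite (big_ord_widen n.+1 (fun k => G k l)) ?leq_subr // big_mkcond.
apply: eq_bigr => k _; case: ltnP => // le_nk.
by rewrite G0 // addnC -leq_subLR.
Qed.

Lemma fps_expMn f j : coefs f 0 = 0 -> fps_exp f ^+ j = fps_exp (f *+ j).
Proof.
move=> f0; elim: j => [|j IHj]; first by rewrite fps_exp0.
by rewrite exprS IHj mulrS fps_expD // coefsMn f0 mul0rn.
Qed.

(* The substitution t := c t. *)
Definition fps_scale c f : fps R := Fps (fun n => c ^+ n * coefs f n).

Lemma coefs_fps_scale c f n : coefs (fps_scale c f) n = c ^+ n * coefs f n.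
Proof. by []. Qed.

Lemma fps_scaleM c f g : fps_scale c (f * g) = fps_scale c f * fps_scale c g.
Proof.
apply: fpsP => n; rewrite /= mulr_sumr; apply: eq_bigr => i _ /=.
by rewrite mulrACA -exprD subnKC ?leq_ord.
Qed.

Lemma fps_scaleD c f g : fps_scale c (f + g) = fps_scale c f + fps_scale c g.
Proof. by apply: fpsP => n; rewrite /= mulrDr. Qed.

Lemma fps_scale1 c : fps_scale c 1 = 1.
Proof. by apply: fpsP => -[|n]; rewrite /= ?mulr1 ?mulr0. Qed.

Lemma fps_scaleX c f k : fps_scale c (f ^+ k) = fps_scale c f ^+ k.
Proof.
by elim: k => [|k IHk]; rewrite ?fps_scale1 // !exprS fps_scaleM IHk.
Qed.

Lemma fps_scale_expCT c a :
  fps_scale c (fps_exp (fpsC a * fpsT)) = fps_exp (fpsC (c * a) * fpsT).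
Proof.
by apply: fpsP => n; rewrite coefs_fps_scale !coefs_expCT mulrA exprMn.
Qed.

(** The series of [e^(-t^2)] has only the terms [(-1)^l t^(2l) / l!], and each meets the term of
    degree [m - 2l] of [e^(at)]. *)
Lemma coefs_exp_quadratic a m :
  coefs (fps_exp (fpsC a * fpsT) * fps_exp (- fpsT ^+ 2)) m =
  \sum_(l < (m %/ 2).+1)
    (-1) ^+ l * a ^+ (m - 2 * l) / (l`!%:R * (m - 2 * l)`!%:R).
Proof.
have T20 : coefs (- fpsT ^+ 2 : fps R) 0 = 0.
  by rewrite coefsN coefs_fpsTX oppr0.
pose G l : R := (-1) ^+ l * a ^+ (m - 2 * l) / (l`!%:R * (m - 2 * l)`!%:R).
rewrite mulrC coefsM.
transitivity (\sum_(i < m.+1) \sum_(l < m.+1)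
    coefs ((- fpsT ^+ 2) ^+ l) i / l`!%:R * (a ^+ (m - i) / (m - i)`!%:R)).
  apply: eq_bigr => i _.
  by rewrite (coefs_exp_widen _ _ m.+1) // coefs_expCT mulr_suml.
rewrite exchange_big /=.
rewrite (big_ord_widen m.+1 G) ?ltnS ?leq_div // [RHS]big_mkcond.
apply: eq_bigr => l _.
have E i : coefs ((- fpsT ^+ 2) ^+ l) i = (-1) ^+ l * (i == (2 * l)%N)%:R :> R.
  rewrite [in LHS]exprNn -[in LHS]exprM -coefs_fpsTX.
  have -> : (-1 : fps R) ^+ l = fpsC ((-1) ^+ l).
    rewrite -fpsCX; congr (_ ^+ l); apply: fpsP => -[|k] //=.
    by rewrite mulr0n oppr0.
  by rewrite coefs_fpsCM.
(* Some index [i <= m] equals [2 * l] exactly when [l <= m %/ 2]; otherwise the inner sum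
   vanishes. *)
rewrite ltnS leq_divRL // mulnC; case: leqP => lt_lm.
  rewrite (bigD1 (Ordinal (lt_lm : 2 * l < m.+1)%N)) //=.
  rewrite big1 => [|i ne_i]; last first.
    by move: ne_i; rewrite -val_eqE E => /negbTE /= ->; rewrite mulr0 !mul0r.
  rewrite E eqxx addr0 /G invrM // mulr1 -!mulrA; congr (_ * _).
  by rewrite mulrCA [X in _ * X]mulrC.
rewrite big1 // => i _; rewrite E ltn_eqF ?mulr0 ?mul0r //.
by rewrite (leq_ltn_trans _ lt_lm) ?leq_ord.
Qed.

End FpsCoefficients.

Arguments fps_scale {R}.

(** * Comparison of the two generating functions *)

Section HermiteEuler.
Variable F : numFieldType.

Lemma hermite_gf_euler r : 2 ^+ r * hermite_gf F =
  fps_scale 2 (euler_gf F r) *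
  \sum_(j < r.+1)
    (fps_exp (fpsC (2 * j%:R) * fpsT) * fps_exp (- fpsT ^+ 2)) *+ 'C(r, j).
Proof.
have Ufact := @fact_poly_unit F.
have CT0 (a : {poly F}) : coefs (fpsC a * fpsT) 0 = 0.
  by rewrite coefs_fpsCM /= mulr0.
have T20 : coefs (- fpsT ^+ 2 : fps {poly F}) 0 = 0.
  by rewrite coefsN coefs_fpsTX oppr0.
have expT c : fps_scale c (fps_exp fpsT) =
    fps_exp (fpsC c * fpsT) :> fps {poly F}.
  rewrite -[c in RHS]mulr1 -fps_scale_expCT; congr (fps_scale c (fps_exp _)).
  by apply: fpsP => n; rewrite coefs_fpsCM mul1r.
(* The denominator cancels because its constant term 2 is a unit. *)
have gfE : euler_gf F r * (fps_exp fpsT + 1) ^+ r =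
    2 ^+ r * fps_exp (fpsC 'X * fpsT).
  by rewrite /euler_gf mulrAC -exprMn divrK ?euler_den_unit.
have gf2E : fps_scale 2 (euler_gf F r) * (fps_exp (fpsC 2 * fpsT) + 1) ^+ r =
    2 ^+ r * fps_exp (fpsC (2 * 'X) * fpsT).
  rewrite -expT -fps_scale_expCT -[X in (_ + X) ^+ r](fps_scale1 _ 2).
  rewrite -fps_scaleD -fps_scaleX -fps_scaleM gfE fps_scaleM fps_scaleX.
  by rewrite fps_scaleD fps_scale1.
rewrite /hermite_gf fps_expD // mulrA -gf2E -mulrA exprD1n mulr_suml.
congr (_ * _); apply: eq_bigr => j _.
(* This exhibits [e^(2jt)] as the [j]-th power of [e^(2t)], the form that the binomial expansion
   produces. *)
have -> : fpsC (2 * j%:R) * fpsT = (fpsC 2 * fpsT) *+ j :> fps {poly F}.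
  by rewrite mulr_natr -fpsCMn mulrnAl.
rewrite -(fps_expMn _ Ufact _ _ (CT0 _)).
exact: mulrnAl.
Qed.

End HermiteEuler.

Theorem theorem4 (F : numFieldType) (r n : nat) :
  hermite F n =
  (2 ^+ r)^-1 *:
    \sum_(k < n.+1)
      (\sum_(j < r.+1) \sum_(l < ((n - k) %/ 2).+1)
         'C(n, k)%:R * 'C(r, j)%:R * 2 ^+ k * (-1) ^+ l * (n - k)`!%:R
           * (2 * j%:R) ^+ (n - k - 2 * l)
           / (l`!%:R * (n - k - 2 * l)`!%:R))
      *: euler F r k.
Proof.
have two_neq0 : 2 ^+ r != 0 :> F by rewrite expf_neq0 ?pnatr_eq0.
apply: (scalerI two_neq0); rewrite scalerA mulfV // scale1r.
(* Scalars become constant polynomials, since the coefficients of the series lie in [{poly F}]. *)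
rewrite -mul_polyC rmorphXn rmorph_nat /hermite mulrCA.
have -> : 2 ^+ r * coefs (hermite_gf F) n = coefs (2 ^+ r * hermite_gf F) n.
  by rewrite -!natrX !mulr_natl coefsMn.
rewrite hermite_gf_euler coefsM mulr_sumr; apply: eq_bigr => k _.
have le_kn : (k <= n)%N by rewrite -ltnS.
rewrite coefs_fps_scale coefs_sum -mul_polyC rmorph_sum /euler.
move: (coefs (euler_gf F r) k) => e.
rewrite !mulr_sumr [RHS]mulr_suml; apply: eq_bigr => j _.
rewrite coefsMn coefs_exp_quadratic; last exact: fact_poly_unit.
rewrite rmorph_sum -[_ *+ 'C(r, j)]mulr_natl !mulr_sumr [RHS]mulr_suml.
apply: eq_bigr => l _ /=.
rewrite fmorph_div !rmorphM !rmorphXn rmorphM rmorphN rmorph1 !rmorph_nat.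
(* The [n!] of the Hermite polynomial splits into ['C(n, k)], the [k!] of the Euler polynomial and
   [(n - k)!]. *)
rewrite -(bin_fact le_kn) !natrM.
move: (_^-1) (_ ^+ (n - k - 2 * l)) (2 ^+ k) ((-1) ^+ l) => v p t s.
ring.
Qed.
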